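(* Consider the two-variable zeta function $\zeta_2(s,z)=\exp\sum_{\ell=1}^\infty\frac{s^\ell}{\ell}\,\Xi_\ell(z)$. Then $$\zeta_2(1,z)=(1-z)\,\zeta_F(z)\qquad\text{and}\qquad\zeta_2(s,1)=\zeta_G(s)$$ wherever the series expansions converge absolutely.
   Context: The Farey map $F:[0,1]\to[0,1]$ is $F(x)=x/(1-x)$ for $0\le x\le1/2$ and $F(x)=(1-x)/x$ for $1/2<x\le1$. The Gauss map is $G(x)=\{1/x\}$ (fractional part) for $x\ne0$, and $\tau(x)=[1/x]$ (integer part). The dynamical zeta functions are $$\zeta_F(z)=\exp\sum_{n=1}^\infty\frac{z^n}{n}Z_n(F),\qquad \zeta_G(s)=\exp\sum_{n=1}^\infty\frac{s^n}{n}Z_n(G),$$ where $$Z_n(F)=\sum_{x=F^n(x)}\prod_{k=0}^{n-1}\frac1{|F'(F^k(x))|},\qquad Z_n(G)=\sum_{x=G^n(x)}\prod_{k=0}^{n-1}\frac1{|G'(G^k(x))|}.$$ The fixed point $x=0$ of $F$ (with $F'(0)=1$) is included in $Z_n(F)$, while the sum in $Z_n(G)$ is over fixed points $x\in(0,1)$ of $G^n$. For $\ell\ge1$, $$\Xi_\ell(z)=\sum_{x=G^\ell(x)}z^{\tau(x)+\tau(G(x))+\dots+\tau(G^{\ell-1}(x))}\prod_{k=0}^{\ell-1}(G^k(x))^2,$$ the sum being over fixed points $x\in(0,1)$ of $G^\ell$, i.e. over all purely periodic continued fractions $x=[\overline{k_1,\dots,k_\ell}]$ with $k_i\ge1$,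 the exponent of $z$ being then $k_1+\dots+k_\ell$. *)

(* Defs.v *)
From HB Require Import structures.
From mathcomp Require Import all_boot all_order all_algebra.
From mathcomp Require Import complex.
From mathcomp Require Import all_classical all_reals all_analysis.
Set Implicit Arguments.
Unset Strict Implicit.
Unset Printing Implicit Defensive.
Import Order.TTheory GRing.Theory Num.Theory.
Import numFieldNormedType.Exports.
Local Open Scope classical_set_scope.
Local Open Scope ring_scope.
Local Open Scope complex_scope.

(* The Farey map, as a total function: the two branches are kept outside
   [0, 1], so that the library derivative at 0 is the one-sided one,
   F'(0) = 1.  The only point of [0, 1] where F' does not exist is 1/2, which
   is not periodic (1/2 -> 1 -> 0 -> 0). *)
Definition farey (R : realType) (x : R) : R :=
  if x <= 2^-1 then x / (1 - x) else (1 - x) / x.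

(* The Gauss map; since 0^-1 = 0, it satisfies gauss 0 = 0, hence an orbit that
   reaches 0 stays there and no point of (0, 1) with such an orbit is periodic. *)
Definition gauss (R : realType) (x : R) : R :=
  x^-1 - (Num.floor x^-1)%:~R.

Definition tau (R : realType) (x : R) : nat := Num.truncn x^-1.

Definition fixF (R : realType) (n : nat) : set R :=
  [set x : R | 0 <= x <= 1 /\ iter n (@farey R) x = x].

Definition fixG (R : realType) (n : nat) : set R :=
  [set x : R | 0 < x < 1 /\ iter n (@gauss R) x = x].

Definition weight (R : realType) (T : R -> R) (n : nat) (x : R) : R :=
  \prod_(k < n) (`|derive1 T (iter k T x)|)^-1.

Definition ZF (R : realType) (n : nat) : R :=
  fine (\esum_(x in @fixF R n) (weight (@farey R) n x)%:E).

Definition ZG (R : realType) (n : nat) : R :=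
  fine (\esum_(x in @fixG R n) (weight (@gauss R) n x)%:E).

Definition cmod (R : realType) (w : R[i]) : R := ComplexField.Normc.normc w.

(* Absolutely convergent sums of complex numbers over an arbitrary index set:
   the real and imaginary parts are summed separately, each as the sum of its
   positive part minus the sum of its negative part. *)
Definition abs_summable (R : realType) (T : choiceType) (D : set T)
    (f : T -> R[i]) : Prop :=
  summable D (fun x => (cmod (f x))%:E).

Definition rsum (R : realType) (T : choiceType) (D : set T) (f : T -> R) : R :=
  fine (\esum_(x in D) (Num.max (f x) 0)%:E)
  - fine (\esum_(x in D) (Num.max (- f x) 0)%:E).

Definition csum (R : realType) (T : choiceType) (D : set T)
    (f : T -> R[i]) : R[i] :=
  rsum D (fun x => complex.Re (f x)) +i* rsum D (fun x => complex.Im (f x)).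

Definition Xi_term (R : realType) (l : nat) (z : R[i]) (x : R) : R[i] :=
  z ^+ (\sum_(k < l) tau (iter k (@gauss R) x))
  * (\prod_(k < l) (iter k (@gauss R) x) ^+ 2)%:C.

Definition Xi (R : realType) (l : nat) (z : R[i]) : R[i] :=
  csum (@fixG R l) (Xi_term l z).

(* The norm topology of the complex plane is carried by the alias R[i]^o. *)
Definition series1 (R : realType) (a : nat -> R[i]) : R[i] :=
  limn ((fun N : nat => \sum_(1 <= n < N.+1) a n) : nat -> R[i]^o).

Definition abs_cvg_series1 (R : realType) (a : nat -> R[i]) : Prop :=
  cvgn (fun N : nat => \sum_(1 <= n < N.+1) cmod (a n)).

Definition cexp (R : realType) (w : R[i]) : R[i] :=
  (expR (complex.Re w))%:C * (cos (complex.Im w) +i* sin (complex.Im w)).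

Definition zetaF_term (R : realType) (z : R[i]) (n : nat) : R[i] :=
  z ^+ n / n%:R * (ZF R n)%:C.

Definition zetaG_term (R : realType) (s : R[i]) (n : nat) : R[i] :=
  s ^+ n / n%:R * (ZG R n)%:C.

Definition zeta2_term (R : realType) (s z : R[i]) (l : nat) : R[i] :=
  s ^+ l / l%:R * Xi l z.

Definition zetaF (R : realType) (z : R[i]) : R[i] :=
  cexp (series1 (zetaF_term z)).

Definition zetaG (R : realType) (s : R[i]) : R[i] :=
  cexp (series1 (zetaG_term s)).

Definition zeta2 (R : realType) (s z : R[i]) : R[i] :=
  cexp (series1 (zeta2_term s z)).

Definition zetaF_abs_cvg (R : realType) (z : R[i]) : Prop :=
  abs_cvg_series1 (zetaF_term z).

Definition zetaG_abs_cvg (R : realType) (s : R[i]) : Prop :=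
  abs_cvg_series1 (zetaG_term s).

(* Each inner sum Xi_l(z) and the outer series over l converge absolutely;
   for s != 0 this is implied by absolute convergence of the double series over
   l and x. *)
Definition zeta2_abs_cvg (R : realType) (s z : R[i]) : Prop :=
  (forall l : nat, (0 < l)%N -> abs_summable (@fixG R l) (Xi_term l z))
  /\ abs_cvg_series1 (zeta2_term s z).

(* Main.v *)
(** The Gauss map is the Farey map accelerated past its visits to (1/2, 1]: if
    tau(x) = k, then F^k(x) = G(x), the orbit x, F(x), ..., F^(k-1)(x) meets
    (1/2, 1] only at its last point, and |(F^k)'(x)| = x^-2.  A fixed point x of
    G^l with digit sum n is therefore the same thing as a nonzero fixed point of
    F^n whose predecessor F^(n-1)(x) on the cycle lies in (1/2, 1], and whose
    cycle visits (1/2, 1] exactly l times; the two weights agree.  Averaging over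
    the n points of a Farey cycle, l of which have such a predecessor, turns the
    factor 1/l into 1/n, so that sum_l Xi_l(z) / l = sum_n z^n / n (Z_n(F) - 1).
    The 1 comes from the neutral fixed point 0; it forces |z| < 1 and produces
    the factor exp (sum_n z^n / n) = 1 / (1 - z). *)

Require Import Defs.
From mathcomp Require Import all_boot all_order all_algebra.
From mathcomp Require Import complex.
From mathcomp Require Import all_classical all_reals all_analysis.
From mathcomp Require Import ring lra.
Set Implicit Arguments.
Unset Strict Implicit.
Unset Printing Implicit Defensive.
Import Order.TTheory GRing.Theory Num.Theory.
Import numFieldNormedType.Exports.
Local Open Scope classical_set_scope.
Local Open Scope ring_scope.
Local Open Scope complex_scope.

(** * Farey and Gauss orbits *)

Lemma esumZl (R : realType) (T : choiceType) (D : set T) (a : T -> \bar R) (c : R) :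
  0 <= c -> (forall x, D x -> (0 <= a x)%E) ->
  (\esum_(x in D) (c%:E * a x) = c%:E * \esum_(x in D) a x)%E.
Proof.
move=> c0 a0; rewrite /esum -ereal_supZl//; last first.
  apply/set0P; exists (\sum_(x \in set0) a x)%E; exists set0 => //.
  exact: fsets_set0.
have Z A : finite_set A -> A `<=` D ->
    (\sum_(x \in A) (c%:E * a x) = c%:E * \sum_(x \in A) a x)%E.
  move=> fA AD; rewrite !fsbig_finite// big_seq [in RHS]big_seq ge0_sume_distrr//.
  by move=> x; rewrite in_fset_set// inE => /AD /a0.
congr ereal_sup; apply/seteqP; split => [_ [A [fA AD] <-]|_ [_ [A [fA AD] <-] <-]].
  by exists (\sum_(x \in A) a x)%E; [exists A|rewrite Z].
by exists A => //; rewrite Z.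
Qed.

(** Starting one step later drops [f z] and appends [f (iter n t z)], which is [f z] again. A
    general monoid serves both the product of factors and the count of visits. *)
Lemma big_orbit_shift (T I : Type) (idx : I) (op : Monoid.com_law idx)
    (f : T -> I) (t : T -> T) n (z : T) : iter n t z = z ->
  \big[op/idx]_(j < n) f (iter j t (t z)) = \big[op/idx]_(j < n) f (iter j t z).
Proof.
case: n => [|n] nz; first by rewrite !big_ord0.
rewrite big_ord_recr big_ord_recl /= Monoid.mulmC -iterSr nz.
by congr (op _ _); apply: eq_bigr => j _; rewrite -iterSr.
Qed.

Section FareyGauss.
Variable R : realType.
Implicit Types (x y : R) (n l : nat).
Local Notation F := (@farey R).
Local Notation G := (@gauss R).
Local Notation fixF0 n := (fixF n `&` ~` [set (0 : R)]).

(** On a cycle this is the number of Gauss steps contained in [n] Farey steps. *)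
Definition visits n x : nat := (\sum_(j < n) (2^-1 < iter j F x)%R)%N.
Definition digit_sum l x : nat := (\sum_(k < l) tau (iter k G x))%N.
(** A closed form of 1/|F'(x)| for x in [0, 1] other than 1/2. *)
Definition farey_factor x : R := if x <= 2^-1 then (1 - x) ^+ 2 else x ^+ 2.

Definition farey_prod n x : R := \prod_(j < n) farey_factor (iter j F x).
Definition gauss_prod l x : R := \prod_(k < l) iter k G x ^+ 2.

Lemma visitsS n x : visits n.+1 x = ((2^-1 < x)%R + visits n (F x))%N.
Proof.
rewrite /visits big_ord_recl; congr addn.
by apply: eq_bigr => i _; rewrite -iterSr.
Qed.

Lemma digit_sumS l x : digit_sum l.+1 x = (tau x + digit_sum l (G x))%N.
Proof.
rewrite /digit_sum big_ord_recl; congr addn.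
by apply: eq_bigr => i _; rewrite -iterSr.
Qed.

Lemma prod_iterS (f : R -> R) (T : R -> R) n x :
  \prod_(k < n.+1) f (iter k T x) = f x * \prod_(k < n) f (iter k T (T x)).
Proof.
rewrite big_ord_recl; congr (_ * _).
by apply: eq_bigr => i _; rewrite -iterSr.
Qed.

(** In the coordinate 1/x the left branch is subtraction of 1. It therefore preserves the fractional
    part, which is G, and lowers the integer part [tau] by one. *)
Lemma farey_inv x : 0 < x <= 2^-1 -> (F x)^-1 = x^-1 - 1.
Proof.
move=> /andP[x0 x2]; rewrite /farey x2 invf_div.
by rewrite mulrBl divff ?gt_eqF// mul1r.
Qed.

Lemma gauss_farey x : 0 < x <= 2^-1 -> G (F x) = G x.
Proof.
move=> hx; rewrite /gauss farey_inv//.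
have -> : Num.floor (x^-1 - 1) = Num.floor x^-1 - 1.
  by rewrite floorDrz ?floorN ?floor1 ?rpredN ?rpred1.
by rewrite intrB; ring.
Qed.

Lemma tau_farey x : 0 < x <= 2^-1 -> tau x = (tau (F x)).+1.
Proof.
move=> hx; rewrite /tau farey_inv//.
have x2 : 2 <= x^-1.
  by move: hx => /andP[x0 x2]; rewrite -[leLHS]invrK lef_pV2 ?posrE ?invr_gt0.
apply: truncn_def.
have /truncn_itv : 0 <= x^-1 - 1 by lra.
move=> /andP[]; set t := (Num.truncn _).
by rewrite -[t.+2%:R]natr1 -[t.+1%:R]natr1; lra.
Qed.

Lemma tau_right x : 2^-1 < x <= 1 -> tau x = 1%N.
Proof.
move=> /andP[x2 x1]; have x0 : 0 < x by lra.
apply: truncn_def; apply/andP; split.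
  by rewrite invf_ge1.
by rewrite -[ltRHS]invrK ltf_pV2 // posrE invr_gt0.
Qed.

Lemma gauss_right x : 2^-1 < x <= 1 -> G x = F x.
Proof.
move=> /[dup] hx /andP[x2 x1]; have x0 : 0 < x by lra.
have -> : F x = x^-1 - 1.
  by rewrite /farey leNgt x2 /= mulrBl mul1r divff ?gt_eqF.
rewrite /gauss; congr (_ - _).
have := tau_right hx; rewrite /tau truncn_floor invr_ge0 ltW//.
have : 0 <= Num.floor x^-1 by rewrite floor_ge0 invr_ge0 ltW.
by case: (Num.floor _) => //= n _ ->.
Qed.

(* The orbit of the first [n] steps is cut after each visit to (1/2, 1], each
   piece being one step of the Gauss map. *)
Lemma farey_gauss n x :
  (forall j, (j < n)%N -> 0 < iter j F x <= 1) ->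
  (n != 0%N -> 2^-1 < iter n.-1 F x) ->
  [/\ iter (visits n x) G x = iter n F x,
      digit_sum (visits n x) x = n &
      gauss_prod (visits n x) x = farey_prod n x].
Proof.
rewrite /gauss_prod /farey_prod; elim: n x => [|n IH] x Ho Hl.
  by rewrite /visits big_ord0 /digit_sum !big_ord0.
have x01 : 0 < x <= 1 by exact: (Ho 0%N).
have Ho' j : (j < n)%N -> 0 < iter j F (F x) <= 1.
  by move=> jn; rewrite -iterSr; exact: Ho.
have Hl' : n != 0%N -> 2^-1 < iter n.-1 F (F x).
  by case: n Hl {Ho Ho' IH} => // n /(_ isT) /=; rewrite -iterSr.
have [E1 E2 E3] := IH _ Ho' Hl'.
rewrite (prod_iterS farey_factor) -E3 visitsS iterSr -E1 {1}/farey_factor.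
case: (leP x 2^-1) => x2 /=; last first.
  rewrite add0n -iterS !add1n iterSr digit_sumS (prod_iterS (fun y => y ^+ 2)).
  have xr : 2^-1 < x <= 1 by rewrite x2; case/andP: x01.
  by rewrite gauss_right// tau_right// E2.
have xl : 0 < x <= 2^-1 by rewrite x2 andbT; case/andP: x01.
rewrite add0n.
(* A visit is still to come: otherwise [E2] gives [n = 0], and [Hl] then puts [x] itself in (1/2,
   1]. So there is a next Gauss step to absorb this left step. *)
have : (0 < visits n (F x))%N.
  rewrite lt0n; apply/eqP => v0; move: E2; rewrite v0 /digit_sum big_ord0 => n0.
  by move: Hl; rewrite -n0 /= => /(_ isT); rewrite ltNge x2.
case: (visits _ _) E1 E2 E3 => // l E1 E2 E3 _.
rewrite !iterSr gauss_farey //; split => //.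
  by move: E2; rewrite !digit_sumS gauss_farey// (tau_farey xl) => <-.
rewrite !(prod_iterS (fun y => y ^+ 2)) gauss_farey// mulrA; congr (_ * _).
(* On the left branch (1 - x) F(x) = x, so the Farey factor of x turns the Gauss factor F(x)^2 into
   x^2. *)
rewrite -exprMn; congr (_ ^+ 2); rewrite /farey x2 mulrCA divff ?mulr1//.
by rewrite gt_eqF//; case/andP: xl; lra.
Qed.

(** Induction on [tau x], which every left step lowers by one; the witness [k] is [tau x] minus
    1. *)
Lemma gauss_block x : 0 < x <= 1 -> exists k,
  [/\ iter k.+1 F x = G x, visits k.+1 x = 1%N, 2^-1 < iter k F x &
     forall j, (j <= k)%N -> 0 < iter j F x <= 1].
Proof.
move En : (tau x) => n; elim: n x En => [|n IH] x En x01.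
  exfalso; move: En; rewrite /tau => En.
  have : (0 < Num.truncn x^-1)%N by case/andP: x01 => *; rewrite truncn_gt0 invf_ge1.
  by rewrite En.
case: (leP x 2^-1) => x2; last first.
  exists 0%N; split => //=.
  - by rewrite gauss_right//; case/andP: x01 => _ ->; rewrite x2.
  - by rewrite /visits big_ord1 /= x2.
  - by case=> [|[]].
have xl : 0 < x <= 2^-1 by rewrite x2 andbT; case/andP: x01.
have F01 : 0 < F x <= 1.
  move: xl => /andP[x0 _]; rewrite /farey x2 divr_gt0//=; last lra.
  by rewrite ler_pdivrMr; lra.
have tF : tau (F x) = n by move: En; rewrite tau_farey// => -[].
have [k [E1 E2 E3 E4]] := IH _ tF F01.
exists k.+1; split.
- by rewrite iterSr E1 gauss_farey.
- by rewrite visitsS E2 ltNge x2.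
- by rewrite iterSr.
- by case=> [//|j jk]; rewrite iterSr; apply: E4.
Qed.

Lemma visitsD m n x : visits (m + n) x = (visits m x + visits n (iter m F x))%N.
Proof.
elim: m x => [|m IH] x; first by rewrite /visits big_ord0.
by rewrite addSn !visitsS iterSr IH addnA.
Qed.

(** The direction opposite to [farey_gauss]: the blocks of successive Gauss steps are concatenated.
    Each block starts its last step in (1/2, 1], whence the condition on the predecessor. *)
Lemma gauss_farey_time l x :
  (forall k, (k < l)%N -> 0 < iter k G x <= 1) ->
  exists n, [/\ iter n F x = iter l G x, visits n x = l,
    (n != 0%N -> 2^-1 < iter n.-1 F x) &
    forall j, (j < n)%N -> 0 < iter j F x <= 1].
Proof.
elim: l => [|l IH] Ho.
  by exists 0%N; split => //; rewrite /visits big_ord0.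
have [n [E1 E2 E3 E4]] := IH (fun k kl => Ho k (ltnW kl)).
have [k [E5 E6 E7 E8]] := gauss_block (Ho l (ltnSn l)).
exists (k.+1 + n)%N; split.
- by rewrite iterD E1 E5.
- by rewrite addnC visitsD E2 E1 E6 addn1.
- by move=> _; rewrite addSn /= iterD E1.
- move=> j jn; case: (ltnP j n) => [|nj]; first exact: E4.
  by rewrite -(subnK nj) iterD E1; apply: E8; rewrite leq_subLR addnC -ltnS -addSn.
Qed.

(** * Periodic points, derivatives and weights *)

Lemma farey_ge0_le1 x : 0 <= x <= 1 -> 0 <= F x <= 1.
Proof.
move=> /andP[x0 x1]; rewrite /farey; case: (leP x 2^-1) => x2.
  by rewrite divr_ge0 ?ler_pdivrMr; lra.
by rewrite divr_ge0 ?ler_pdivrMr; lra.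
Qed.

Lemma iter_farey_ge0_le1 n x : 0 <= x <= 1 -> 0 <= iter n F x <= 1.
Proof. by move=> x01; elim: n => //= n; exact: farey_ge0_le1. Qed.

Lemma iter_farey0 n : iter n F 0 = 0.
Proof. by elim: n => //= n ->; rewrite /farey invr_ge0 ler0n mul0r. Qed.

Lemma fixF_orbit n x j : (0 < n)%N -> fixF n x -> x != 0 ->
  0 < iter j F x <= 1.
Proof.
move=> n0 [x01 Fx] xn0; have /andP[j0 ->] := iter_farey_ge0_le1 j x01.
rewrite andbT lt0r j0 andbT; apply: contra xn0 => /eqP j00.
(* The multiple [j * n] of the period is at least [j], and 0 is absorbing, so a zero at time [j]
   would force [x = 0]. *)
have Fk k : iter (k * n) F x = x by elim: k => // k IH; rewrite mulSn iterD IH.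
by rewrite -(Fk j) -(subnK (leq_pmulr j n0)) iterD j00 iter_farey0.
Qed.

(** The point 1/2 goes to 1 and then to 0, which a nonzero cycle never meets. *)
Lemma fixF_orbit_neq n x j : (0 < n)%N -> fixF n x -> x != 0 ->
  iter j F x != 2^-1.
Proof.
move=> n0 Fx xn0; apply/eqP => j2.
have := fixF_orbit j.+2 n0 Fx xn0; rewrite !iterS j2.
have -> : F 2^-1 = 1 by rewrite /farey lexx; field.
by rewrite /farey; case: ifP => h; rewrite ?subrr ?mul0r ?invr0 ?mulr0 ltxx.
Qed.

Lemma norm_derive1_farey x : 0 <= x <= 1 -> x != 2^-1 ->
  (`|derive1 F x|)^-1 = farey_factor x.
Proof.
move=> /andP[x0 x1]; rewrite neq_lt /farey_factor => /orP[x2|x2].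
  have D : is_derive x 1 F ((1 - x) ^- 2).
    apply: (near_eq_is_derive (f := fun y => y / (1 - y))).
      near=> y; rewrite /farey ifT//; near: y.
      (* This radius keeps [y] on the left branch; around [x = 0] it admits negative [y], where the
         total map [farey] follows the same formula. *)
      by exists (2^-1 - x) => /=; [lra|move=> y /=; rewrite ltr_norml; lra].
    have x1n : 1 - x != 0 by lra.
    have dV := is_deriveV (f := fun y => 1 - y) (x := x) (v := 1) x1n _.
    by apply: is_derive_eq; rewrite /GRing.scale/=; field.
  rewrite derive1E derive_val (ltW x2) ger0_norm ?invrK//.
  by rewrite invr_ge0 exprn_ge0//; lra.
have D : is_derive x 1 F (- x ^- 2).
  apply: (near_eq_is_derive (f := fun y => (1 - y) / y)).
    near=> y; rewrite /farey ifF//; apply/negbTE; rewrite -ltNge; near: y.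
    by exists (x - 2^-1) => /=; [lra|move=> y /=; rewrite ltr_norml; lra].
  have xn : x != 0 by lra.
  have dV := is_deriveV (f := id) (x := x) (v := 1) xn _.
  by apply: is_derive_eq; rewrite /GRing.scale/=; field.
rewrite derive1E derive_val leNgt x2 normrN ger0_norm ?invrK//.
by rewrite invr_ge0 exprn_ge0.
Unshelve. all: by end_near.
Qed.

(** The condition [G x != 0] says that 1/x is not an integer, so the floor of 1/y is constant for y
    near x. *)
Lemma norm_derive1_gauss x : 0 < x -> G x != 0 ->
  (`|derive1 G x|)^-1 = x ^+ 2.
Proof.
move=> x0 Gx; have xn : x != 0 by lra.
have D : is_derive x 1 G (- x ^- 2).
  apply: (near_eq_is_derive (f := fun y => y^-1 - (Num.floor x^-1)%:~R)).
    have cV : {for x, continuous (@GRing.inv R)} by exact: inv_continuous.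
    have /andP[f1 f2] := floor_itv x^-1.
    have f3 : (Num.floor x^-1)%:~R < x^-1.
      by rewrite lt_neqAle f1 andbT; move: Gx; rewrite /gauss subr_eq0 eq_sym.
    near=> y; rewrite /gauss; congr (_ - _%:~R); apply/esym/floor_def.
    apply/andP; split.
      by apply: ltW; near: y; exact: (cvgr_gt _ cV).
    by near: y; exact: (cvgr_lt _ cV).
  have dV := is_deriveV (f := id) (x := x) (v := 1) xn _.
  by apply: is_derive_eq; rewrite /GRing.scale/=; field.
rewrite derive1E derive_val normrN ger0_norm ?invrK//.
by rewrite invr_ge0 exprn_ge0// ltW.
Unshelve. all: by end_near.
Qed.

Lemma weight_farey n x : (0 < n)%N -> fixF n x -> x != 0 ->
  weight F n x = farey_prod n x.
Proof.
move=> n0 Fx x0; apply: eq_bigr => j _; apply: norm_derive1_farey.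
  by case: Fx => /(iter_farey_ge0_le1 j).
exact: fixF_orbit_neq Fx x0.
Qed.

Lemma fixG_orbit l x k : (0 < l)%N -> fixG l x -> 0 < iter k G x < 1.
Proof.
move=> l0 [x01 Gx].
have G01 y : 0 <= G y < 1.
  rewrite /gauss; have /andP[] := floor_itv y^-1; rewrite intrD mulr1z; lra.
have G0 m : iter m G 0 = 0.
  by elim: m => //= m ->; rewrite /gauss invr0 floor0 subrr.
have /andP[k0 k1] : 0 <= iter k G x < 1 by case: k => [|k]; [rewrite /=; lra|exact: G01].
rewrite k1 andbT lt0r k0 andbT; apply/eqP => k00.
have Gj j : iter (j * l) G x = x by elim: j => // j IH; rewrite mulSn iterD IH.
move: x01; rewrite -(Gj k) -(subnK (leq_pmulr k l0)) iterD k00 G0; lra.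
Qed.

Lemma weight_gauss l x : (0 < l)%N -> fixG l x ->
  weight G l x = gauss_prod l x.
Proof.
move=> l0 Gx; apply: eq_bigr => k _; apply: norm_derive1_gauss.
  by case/andP: (fixG_orbit k l0 Gx).
by rewrite -iterS gt_eqF//; case/andP: (fixG_orbit k.+1 l0 Gx).
Qed.

(** * Expansion and finiteness of the periodic points *)

Lemma farey_factor_ge0 x : 0 <= farey_factor x.
Proof. by rewrite /farey_factor; case: ifP => _; rewrite exprn_even_ge0. Qed.

(** On a branch the difference quotient has absolute value 1/(xy) or 1/((1 - x)(1 - y)), and both
    products are below 1. *)
Lemma farey_expanding x y : 0 < x <= 1 -> 0 < y <= 1 ->
  (2^-1 < x) = (2^-1 < y) -> x != y -> `|x - y| < `|F x - F y|.
Proof.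
move=> hx hy xy nxy; have d0 : 0 < `|x - y| by rewrite normr_gt0 subr_eq0.
rewrite /farey leNgt [y <= _]leNgt -xy; case: (ltP 2^-1 x) => /= x2.
  have -> : (1 - x) / x - (1 - y) / y = - (x - y) / (x * y).
    by field; apply/andP; split; lra.
  have xy0 : 0 < x * y by rewrite mulr_gt0; lra.
  have xy1 : x * y < 1.
    (* At x = 1 the derivative of F has modulus 1; strictness then comes from y < 1. *)
    have [x1|x1] := ltP x 1; first by nra.
    by have : y < 1; [rewrite lt_neqAle; move: nxy; rewrite (_ : x = 1) 1?eq_sym; lra|nra].
  by rewrite normrM normrN normfV (gtr0_norm xy0) ltr_pdivlMr// gtr_pMr.
have y2 : y <= 2^-1 by rewrite leNgt -xy -leNgt.
have -> : x / (1 - x) - y / (1 - y) = (x - y) / ((1 - x) * (1 - y)).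
  by field; apply/andP; split; lra.
have xy0 : 0 < (1 - x) * (1 - y) by rewrite mulr_gt0; lra.
have xy1 : (1 - x) * (1 - y) < 1 by nra.
by rewrite normrM normfV (gtr0_norm xy0) ltr_pdivlMr// gtr_pMr.
Qed.

Lemma finite_fixF n : (0 < n)%N -> finite_set (fixF0 n).
Proof.
move=> n0.
(* An itinerary with respect to 1/2 determines a periodic point, since [F]
   strictly expands distances on either branch. *)
pose code x := [ffun j : 'I_n => 2^-1 < iter j F x].
suff inj : {in fixF0 n &, injective code}.
  by rewrite -(eq_finite_set (inj_card_eq inj)); exact: finite_finset.
move=> x y /set_mem[Fx /eqP x0] /set_mem[Fy /eqP y0] /ffunP cxy.
apply/eqP; apply: contraT => nxy.
suff : `|x - y| < `|iter n F x - iter n F y|.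
  by case: Fx Fy => [_ ->] [_ ->]; rewrite ltxx.
have step j : (j < n)%N -> iter j F x != iter j F y ->
    `|iter j F x - iter j F y| < `|iter j.+1 F x - iter j.+1 F y|.
  move=> jn; apply: farey_expanding;
    [exact: fixF_orbit Fx _|exact: fixF_orbit Fy _|].
  by have := cxy (Ordinal jn); rewrite !ffunE.
suff H m : (m < n)%N -> `|x - y| < `|iter m.+1 F x - iter m.+1 F y|.
  by rewrite -(prednK n0) H// prednK.
elim: m => [|m IH] mn; first exact: (step 0%N).
have {}IH := IH (ltnW mn); apply: (lt_trans IH); apply: step => //.
by rewrite -subr_eq0 -normr_gt0 (le_lt_trans _ IH).
Qed.

(** * Averaging over Farey cycles *)

Lemma fixF_iter n j x : (0 < n)%N -> fixF0 n x -> fixF0 n (iter j F x).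
Proof.
move=> n0 [Fx /eqP x0]; have /andP[j0 j1] := fixF_orbit j n0 Fx x0.
split; last by move=> /= j00; rewrite j00 ltxx in j0.
split; first by rewrite ltW.
by rewrite -iterD addnC iterD; case: Fx => _ ->.
Qed.

Lemma farey_bij n : (0 < n)%N -> set_bij (fixF0 n) (fixF0 n) F.
Proof.
move=> n0; split.
- by move=> x; exact: (@fixF_iter n 1%N).
- move=> x y /set_mem[[_ Fx] _] /set_mem[[_ Fy] _] xy.
  by rewrite -Fx -Fy -(prednK n0) !iterSr xy.
- move=> x Px; exists (iter n.-1 F x); first exact: fixF_iter.
  by rewrite -iterS prednK//; case: Px => -[].
Qed.

(** F permutes the nonzero fixed points of F^n. This makes the [n] shifted sums in [esum_fixF_cycle]
    equal. *)
Lemma esum_farey_iter n j (h : R -> \bar R) : (0 < n)%N ->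
  (\esum_(x in fixF0 n) h (iter j F x) = \esum_(x in fixF0 n) h x)%E.
Proof.
move=> n0; elim: j => [//|j IH].
rewrite -IH [RHS](@reindex_esum _ _ _ _ _ _ _ (farey_bij n0)).
by apply: eq_esum => x _; rewrite iterSr.
Qed.

Lemma farey_prod_ge0 n x : 0 <= farey_prod n x.
Proof. by apply: prodr_ge0 => j _; exact: farey_factor_ge0. Qed.

Lemma gauss_prod_ge0 l x : 0 <= gauss_prod l x.
Proof. by apply: prodr_ge0 => k _; exact: exprn_even_ge0. Qed.

Lemma farey_prod_iter n x j : iter n F x = x -> farey_prod n (iter j F x) = farey_prod n x.
Proof.
move=> nx; elim: j => //= j <-; apply: (big_orbit_shift *%R).
by rewrite -iterD addnC iterD nx.
Qed.

Lemma visits_iter n x j : iter n F x = x -> visits n (iter j F x) = visits n x.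
Proof.
move=> nx; elim: j => //= j <-.
apply: (big_orbit_shift addn (fun y : R => nat_of_bool (2^-1 < y))).
by rewrite -iterD addnC iterD nx.
Qed.

(** A cycle inside (0, 1/2] would lower [tau] at every step, so that [tau x + n = tau x]. *)
Lemma visits_gt0 n x : (0 < n)%N -> fixF0 n x -> (0 < visits n x)%N.
Proof.
move=> n0 [Fx /eqP x0]; rewrite lt0n; apply/eqP => /eqP v0.
have left_half j : (j < n)%N -> 0 < iter j F x <= 2^-1.
  move=> jn; have /andP[-> _] := fixF_orbit j n0 Fx x0.
  move: v0; rewrite /visits sum_nat_eq0 => /forallP/(_ (Ordinal jn))/=.
  by rewrite eqb0 -leNgt.
have tau_iter j : (j <= n)%N -> (tau (iter j F x) + j)%N = tau x.
  elim: j => [|j IH] jn; first by rewrite addn0.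
  by rewrite -(IH (ltnW jn)) (tau_farey (left_half _ jn)) addnS.
have := tau_iter n (leqnn n); case: Fx => _ ->.
by move/eqP; rewrite -[X in _ == X]addn0 eqn_add2l -leqn0 leqNgt n0.
Qed.

Lemma esum_fixF_fin n (h : R -> R) : (0 < n)%N -> (forall x, 0 <= h x) ->
  (\esum_(x in fixF0 n) (h x)%:E)%E \is a fin_num.
Proof.
move=> n0 h0; have fP := finite_fixF n0.
rewrite esum_fset// => [|x _]; last by rewrite lee_fin.
by rewrite fsbig_finite//; apply/sum_fin_numP.
Qed.

Lemma esum_fixF_cycle n (c : R) : (0 < n)%N -> 0 <= c ->
  (\esum_(x in fixF0 n `&` [set x | (2^-1 < iter n.-1 F x)%R])
     (c * farey_prod n x / (visits n x)%:R)%:E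
   = (c / n%:R)%:E * \esum_(x in fixF0 n) (farey_prod n x)%:E)%E.
Proof.
move=> n0 c0.
(* Averaging over the cycle: the mass of each point is split evenly among the
   [visits n x] points of its cycle preceded by a point of (1/2, 1]. *)
pose h x := (c * farey_prod n x / (visits n x)%:R * (2^-1 < iter n.-1 F x)%R%:R)%:E.
have h0 x : (0 <= h x)%E by rewrite lee_fin !mulr_ge0 ?invr_ge0 ?farey_prod_ge0.
rewrite esum_mkcondr; under eq_esum => x _.
  rewrite (_ : (if _ then _ else _) = h x); last first.
    rewrite /h; case: ifPn => [/set_mem /= ->|]; first by rewrite mulr1.
    by move=> /negP; rewrite inE /= => /negP/negbTE ->; rewrite mulr0.
  over.
have E : (\sum_(j < n) \esum_(x in fixF0 n) h (iter j F x)
    = c%:E * \esum_(x in fixF0 n) (farey_prod n x)%:E)%E.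
  rewrite -esum_sum// -esumZl//; last by move=> x _; rewrite lee_fin farey_prod_ge0.
  apply: eq_esum => x Px.
  have nx : iter n F x = x by case: Px => -[].
  have v0 : (visits n x != 0)%N.
    by rewrite -lt0n; exact: visits_gt0 Px.
  rewrite sumEFin -EFinM; congr EFin; rewrite /h.
  under eq_bigr => j _ do rewrite farey_prod_iter// visits_iter//.
  rewrite -mulr_sumr.
  (* As [j] runs over a period, the predecessors run over the whole cycle, so the indicators count
     the visits and cancel the denominator. *)
  have -> : \sum_(j < n) (2^-1 < iter n.-1 F (iter j F x))%R%:R = (visits n x)%:R :> R.
    rewrite -(visits_iter n.-1 nx) /visits natr_sum; apply: eq_bigr => j _.
    by rewrite -!iterD addnC.
  by rewrite divfK// pnatr_eq0.
(* Finiteness lets the [n] equal sums be divided by [n]. *)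
have fin : (\esum_(x in fixF0 n) h x)%E \is a fin_num.
  exact: esum_fixF_fin.
move: E; under eq_bigr => j _ do rewrite esum_farey_iter//.
rewrite (mulrC c) EFinM -muleA => <-; rewrite -(fineK fin) sumEFin -EFinM.
by rewrite sumr_const card_ord -[X in _ * X]mulr_natl mulKf// pnatr_eq0 -lt0n.
Qed.

(** * The correspondence between Farey and Gauss periodic points *)

Lemma farey_gauss_periodic n x : (0 < n)%N -> fixF0 n x -> 2^-1 < iter n.-1 F x ->
  [/\ iter (visits n x) G x = iter n F x,
      digit_sum (visits n x) x = n &
      gauss_prod (visits n x) x = farey_prod n x].
Proof.
move=> n0 [Fx /eqP x0] lx; apply: farey_gauss => // j _.
exact: fixF_orbit Fx x0.
Qed.

(** The point is kept and the period [n] is traded for the number of visits. Injectivity holds since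
    [n] is recovered as the digit sum; [gauss_farey_time] gives surjectivity. *)
Lemma fixF_fixG_bij :
  set_bij
    ([set n | (0 < n)%N] `*``
       (fun n => fixF0 n `&` [set x | (2^-1 < iter n.-1 F x)%R]))
    ([set l | (0 < l)%N] `*`` (fun l => @fixG R l))
    (fun p : nat * R => (visits p.1 p.2, p.2)).
Proof.
split.
- move=> [n x] /= [n0 [Px lx]]; have [E1 _ _] := farey_gauss_periodic n0 Px lx.
  split => /=; first exact: visits_gt0.
  have [Fx /eqP x0] := Px; split; last by rewrite E1; case: Fx.
  have /andP[/= -> x1] := fixF_orbit 0 n0 Fx x0.
  (* [fixG] omits the endpoint 1, which F sends to 0. *)
  rewrite lt_neqAle x1 andbT; apply/eqP => x11.
  have := fixF_orbit 1 n0 Fx x0; rewrite /= x11 /farey.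
  by case: ifP => h; rewrite ?subrr ?invr0 ?mulr0 ?mul0r ltxx.
- move=> [n x] [m y] /set_mem/= [n0 [Px lx]] /set_mem/= [m0 [Py ly]] [vE xy].
  congr pair => //; have [_ <- _] := farey_gauss_periodic n0 Px lx.
  by have [_ <- _] := farey_gauss_periodic m0 Py ly; rewrite vE xy.
- move=> [l x] /= [l0 Gx].
  have Go k : (k < l)%N -> 0 < iter k G x <= 1.
    by move=> _; have /andP[-> /ltW] := fixG_orbit k l0 Gx.
  have [n [E1 E2 E3 E4]] := gauss_farey_time Go.
  have n0 : (0 < n)%N.
    by rewrite lt0n; apply/eqP => n0; move: l0; rewrite -E2 n0 /visits big_ord0.
  have x01 := fixG_orbit 0 l0 Gx.
  exists (n, x) => /=; last by rewrite E2.
  split => //; split; last by apply: E3; rewrite -lt0n.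
  split; last by move=> /= x0; move: x01; rewrite /= x0 ltxx.
  split; last by rewrite E1; case: Gx.
  by move: x01 => /= /andP[/ltW -> /ltW ->].
Qed.

(** All terms are nonnegative, so the double sums may be reindexed freely in the extended reals. The
    coefficients [b] will come from the powers of z. *)
Lemma esum_gauss_farey (b : nat -> R) : (forall n, 0 <= b n) ->
  (\esum_(l in [set l | (0 < l)%N]) \esum_(x in @fixG R l)
     (b (digit_sum l x) * gauss_prod l x / l%:R)%:E
   = \esum_(n in [set n | (0 < n)%N])
     (b n / n%:R)%:E * \esum_(x in fixF0 n) (farey_prod n x)%:E)%E.
Proof.
move=> b0; rewrite esum_esum; last first.
  move=> l x _ _; rewrite lee_fin !mulr_ge0 ?invr_ge0//.
  exact: gauss_prod_ge0.
rewrite (@reindex_esum _ _ _ _ _ _ _ fixF_fixG_bij).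
under [RHS]eq_esum => n n0 do rewrite -esum_fixF_cycle//.
rewrite [RHS]esum_esum; last first.
  by move=> n x _ _; rewrite lee_fin !mulr_ge0 ?invr_ge0 ?farey_prod_ge0.
apply: eq_esum => -[n x] [/= n0 [Px lx]].
by have [_ -> ->] := farey_gauss_periodic n0 Px lx.
Qed.

End FareyGauss.

(** * The logarithmic series *)

Section ComplexLog.
Variable R : realType.
Implicit Types (z w : R[i]) (t : R) (n N : nat).
Local Notation Re := (@complex.Re R).
Local Notation Im := (@complex.Im R).

Lemma Re_mulc z w : Re (z * w) = Re z * Re w - Im z * Im w.
Proof. by case: z w => a b [c d]. Qed.

Lemma Im_mulc z w : Im (z * w) = Re z * Im w + Im z * Re w.
Proof. by case: z w => a b [c d]. Qed.

Lemma cmod_ge0 z : 0 <= cmod z.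
Proof. by rewrite -ler0c; exact: (normr_ge0 z). Qed.

Lemma cmodM z w : cmod (z * w) = cmod z * cmod w.
Proof. by case: z w => a b [c d]; exact: ComplexField.Normc.normcM. Qed.

Lemma cmodX z n : cmod (z ^+ n) = cmod z ^+ n.
Proof.
elim: n => [|n IH]; first by rewrite !expr0 /cmod ComplexField.Normc.normc1.
by rewrite !exprS cmodM IH.
Qed.

Lemma ler_Re_cmod z : `|Re z| <= cmod z.
Proof. by rewrite -lecR; exact: normc_ge_Re. Qed.

Lemma ler_Im_cmod z : `|Im z| <= cmod z.
Proof.
have := ler_Re_cmod (z * 'i); rewrite cmodM Re_mulc /= mulr0 mulr1 sub0r normrN.
by rewrite /cmod /ComplexField.Normc.normc /= expr0n expr1n add0r sqrtr1 mulr1.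
Qed.

Lemma cexpD z w : cexp (z + w) = cexp z * cexp w.
Proof.
case: z w => a b [c d]; rewrite /cexp /= expRD cosD sinD.
by apply/eqP; rewrite eq_complex /=; apply/andP; split; apply/eqP; ring.
Qed.

(** With c_n the real or imaginary part of z^n, this is the same part of the N-th partial sum of the
    series of -log(1 - tz). Keeping the two parts apart reduces everything to real calculus in t. *)
Definition log_poly (c : nat -> R) N t : R :=
  \sum_(n < N) c n.+1 / n.+1%:R * t ^+ n.+1.
Definition geom_poly (c : nat -> R) N t : R := \sum_(n < N) c n.+1 * t ^+ n.

Lemma log_poly0 c N : log_poly c N 0 = 0.
Proof. by rewrite /log_poly big1// => n _; rewrite expr0n mulr0. Qed.

Lemma is_derive_log_poly c N t :
  is_derive t 1 (log_poly c N) (geom_poly c N t).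
Proof.
have -> : log_poly c N = \sum_(n < N) (fun t => c n.+1 / n.+1%:R * t ^+ n.+1).
  by apply/funext => u; rewrite fct_sumE.
apply: is_derive_sum => n.
have n0 : n.+1%:R != 0 :> R by rewrite pnatr_eq0.
have dX := is_deriveX n.+1 (is_derive_id t (1 : R)).
have dZ := is_deriveZ (c n.+1 / n.+1%:R) dX.
rewrite (_ : (fun u => _) = (c n.+1 / n.+1%:R) \*: (id ^+ n.+1)); last first.
  by apply/funext => u; rewrite /= exprfctE.
by apply: is_derive_eq; rewrite /GRing.scale/=; field.
Qed.

(** The two parts of the telescoping identity (1 - tz) sum_(n < N) z^(n+1) t^n = z - z^(N+1) t^N. *)
Lemma geom_poly_cplx z N t :
  let c n := Re (z ^+ n) in let s n := Im (z ^+ n) in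
  (1 - t * Re z) * geom_poly c N t + t * Im z * geom_poly s N t
    = Re z - c N.+1 * t ^+ N /\
  (1 - t * Re z) * geom_poly s N t - t * Im z * geom_poly c N t
    = Im z - s N.+1 * t ^+ N.
Proof.
move=> c s; elim: N => [|N [IH1 IH2]].
  by rewrite /geom_poly !big_ord0 /c /s !expr1 expr0; split; ring.
have cE : c N.+2 = Re z * c N.+1 - Im z * s N.+1 by rewrite /c exprS Re_mulc.
have sE : s N.+2 = Re z * s N.+1 + Im z * c N.+1 by rewrite /s exprS Im_mulc.
rewrite /geom_poly !big_ord_recr /= -!/(geom_poly _ _ _) cE sE exprS.
set G := geom_poly c N t in IH1 IH2 *; set H := geom_poly s N t in IH1 IH2 *.
split.
  transitivity ((1 - t * Re z) * G + t * Im z * H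
      + ((1 - t * Re z) * c N.+1 + t * Im z * s N.+1) * t ^+ N); first by ring.
  by rewrite IH1; ring.
transitivity ((1 - t * Re z) * H - t * Im z * G
    + ((1 - t * Re z) * s N.+1 - t * Im z * c N.+1) * t ^+ N); first by ring.
by rewrite IH2; ring.
Qed.

Lemma norm_cos_sin_le1 t : `|cos t| <= 1 /\ `|sin t| <= 1.
Proof. by rewrite !ler_norml cos_geN1 cos_le1 sin_geN1 sin_le1. Qed.

(** Comparison with the geometric series. The bound is uniform in [N] and [t], which later keeps the
    exponential factor [E N t] below [K]. *)
Lemma log_poly_le c N t (r : R) : 0 <= r < 1 -> 0 <= t <= 1 ->
  (forall n, `|c n| <= r ^+ n) -> log_poly c N t <= (1 - r)^-1.
Proof.
move=> /andP[r0 r1] /andP[t0 t1] cr.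
apply: (@le_trans _ _ (\sum_(n < N) r ^+ n)).
  apply: ler_sum => n _; apply: (le_trans (ler_norm _)); rewrite !normrM.
  rewrite normfV (normr_nat _ n.+1) (ger0_norm (exprn_ge0 _ t0)) -[leRHS]mulr1.
  apply: ler_pM; rewrite ?exprn_ge0 ?mulr_ge0 ?exprn_ile1//.
  rewrite -[leRHS]mulr1; apply: ler_pM => //; rewrite ?invr_ge0 ?ler0n//.
    by apply: (le_trans (cr _)); rewrite exprS ler_piMl ?exprn_ge0 // ltW.
  by rewrite invf_le1 ?ltr0n// ler1n.
have r1' : 0 < 1 - r by rewrite subr_gt0.
rewrite -[leRHS]mul1r ler_pdivlMr// mulrC -opprB mulNr -subrX1 opprB.
by rewrite gerBl exprn_ge0.
Qed.

Lemma cvg_dominated0 (f e : nat -> R) : (forall N, `|f N| <= e N) ->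
  e @ \oo --> 0 -> f @ \oo --> 0.
Proof.
move=> fe e0; apply: norm_cvg0; apply: squeeze_cvgr (cvg_cst 0) e0.
by apply: nearW => N; rewrite normr_ge0 fe.
Qed.

(** * The exponential of the logarithmic series, followed along the segment from 0 to z *)

Section Ray.
Variable z : R[i].
Let a := Re z.
Let b := Im z.
Let c n := Re (z ^+ n).
Let s n := Im (z ^+ n).

(* [g N t] and [h N t] are the real and imaginary parts of
   (1 - tz) exp (sum_(1 <= n <= N) (tz)^n / n), whose derivative in t is
   - z (tz)^N exp (...), which tends to 0 with N uniformly on [0, 1]. *)
Let E N t := expR (log_poly c N t).
Let g N t := E N t * ((1 - t * a) * cos (log_poly s N t) + t * b * sin (log_poly s N t)).
Let h N t := E N t * ((1 - t * a) * sin (log_poly s N t) - t * b * cos (log_poly s N t)).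

Let dg N t : is_derive t 1 (g N)
  (E N t * (s N.+1 * sin (log_poly s N t) - c N.+1 * cos (log_poly s N t)) * t ^+ N).
Proof.
have [G1 G2] := geom_poly_cplx z N t.
have dc := is_derive_log_poly c N t.
have ds := is_derive_log_poly s N t.
have dE := is_derive1_comp (is_derive_expR (log_poly c N t)) dc.
have dC := is_derive1_comp (is_derive_cos (log_poly s N t)) ds.
have dS := is_derive1_comp (is_derive_sin (log_poly s N t)) ds.
rewrite /g /E; apply: is_derive_eq; rewrite /GRing.scale/=.
rewrite -!/(c _) -!/(s _) -/a -/b -/c -/s in G1 G2 *.
set C := cos _; set S := sin _; set X := expR _.
transitivity (X * ((s N.+1 * t ^+ N) * S - (c N.+1 * t ^+ N) * C)); last by ring.
(* Written this way, the remainders contain the right-hand sides of [G1] and [G2], which turn back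
   into the [geom_poly] terms produced by the product rule. *)
have -> : c N.+1 * t ^+ N = a - (a - c N.+1 * t ^+ N) by ring.
have -> : s N.+1 * t ^+ N = b - (b - s N.+1 * t ^+ N) by ring.
by rewrite -G1 -G2; ring.
Qed.

Let dh N t : is_derive t 1 (h N)
  (- E N t * (c N.+1 * sin (log_poly s N t) + s N.+1 * cos (log_poly s N t)) * t ^+ N).
Proof.
have [G1 G2] := geom_poly_cplx z N t.
have dc := is_derive_log_poly c N t.
have ds := is_derive_log_poly s N t.
have dE := is_derive1_comp (is_derive_expR (log_poly c N t)) dc.
have dC := is_derive1_comp (is_derive_cos (log_poly s N t)) ds.
have dS := is_derive1_comp (is_derive_sin (log_poly s N t)) ds.
rewrite /h /E; apply: is_derive_eq; rewrite /GRing.scale/=.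
rewrite -!/(c _) -!/(s _) -/a -/b -/c -/s in G1 G2 *.
set C := cos _; set S := sin _; set X := expR _.
transitivity (- X * ((c N.+1 * t ^+ N) * S + (s N.+1 * t ^+ N) * C)); last by ring.
have -> : c N.+1 * t ^+ N = a - (a - c N.+1 * t ^+ N) by ring.
have -> : s N.+1 * t ^+ N = b - (b - s N.+1 * t ^+ N) by ring.
by rewrite -G1 -G2; ring.
Qed.

Hypothesis z1 : cmod z < 1.
Let r := cmod z.
Let K := expR (1 - r)^-1.

Let r01 : 0 <= r < 1.
Proof. by rewrite cmod_ge0. Qed.

Let cr n : `|c n| <= r ^+ n.
Proof. by rewrite -cmodX; exact: ler_Re_cmod. Qed.

Let sr n : `|s n| <= r ^+ n.
Proof. by rewrite -cmodX; exact: ler_Im_cmod. Qed.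

(** One bound for both derivatives, [x] and [y] being a sine and a cosine up to sign: [K] bounds the
    exponential, and [c] and [s] contribute r^(N+1) each. *)
Let df_bound N t (x y : R) : 0 <= t <= 1 -> `|x| <= 1 -> `|y| <= 1 ->
  `|E N t * (c N.+1 * x + s N.+1 * y) * t ^+ N| <= K * (r ^+ N.+1 *+ 2).
Proof.
move=> /[dup] t01 /andP[t0 t1] x1 y1; rewrite -[leRHS]mulr1 normrM; apply: ler_pM => //.
  rewrite normrM; apply: ler_pM => //.
    by rewrite /E gtr0_norm ?expR_gt0// ler_expR; exact: log_poly_le r01 t01 cr.
  rewrite mulr2n; apply: (le_trans (ler_normD _ _)).
  by apply: lerD; rewrite normrM -[leRHS]mulr1; apply: ler_pM.
by rewrite ger0_norm ?exprn_ge0// exprn_ile1.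
Qed.

Let mvt (f df : R -> R) (M : R) : (forall t, is_derive t 1 f (df t)) ->
  (forall t, 0 <= t <= 1 -> `|df t| <= M) -> `|f 1 - f 0| <= M.
Proof.
move=> fdf dfM.
have [|t] := @MVT_segment R f df 0 1 ler01 (fun t _ => fdf t).
  by apply: continuous_subspaceT => t; apply/differentiable_continuous/derivable1_diffP.
by rewrite in_itv /= subr0 mulr1 => t01 ->; exact: dfM.
Qed.

(** Since [g N 0 = 1], the mean value theorem turns the bound on the derivative into closeness to 1
    at t = 1. *)
Let g1 N : `|g N 1 - 1| <= K * (r ^+ N.+1 *+ 2).
Proof.
have g0 : g N 0 = 1.
  by rewrite /g /E !log_poly0 expR0 cos0 sin0; ring.
rewrite -[X in _ - X]g0; apply: (mvt (dg N)) => t t01.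
have [C1 S1] := norm_cos_sin_le1 (log_poly s N t).
rewrite [X in X * _](_ : _ = E N t * (c N.+1 * (- cos (log_poly s N t))
    + s N.+1 * sin (log_poly s N t))); last by ring.
by apply: df_bound; rewrite ?normrN.
Qed.

Let h1 N : `|h N 1| <= K * (r ^+ N.+1 *+ 2).
Proof.
have h0 : h N 0 = 0.
  by rewrite /h /E !log_poly0 expR0 cos0 sin0; ring.
rewrite -[X in `|X|]subr0 -[X in _ - X]h0; apply: (mvt (dh N)) => t t01.
have [C1 S1] := norm_cos_sin_le1 (log_poly s N t).
rewrite mulNr mulNr normrN.
by apply: df_bound.
Qed.

Let log_poly_cvg (d : nat -> R) : (forall n, `|d n| <= r ^+ n) ->
  cvgn (fun N => log_poly d N 1).
Proof.
move=> dr; have /andP[r0 _] := r01.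
have -> : (fun N => log_poly d N 1) = series (fun n => d n.+1 / n.+1%:R).
  apply/funext => N; rewrite /log_poly /series /= big_mkord.
  by apply: eq_bigr => n _; rewrite expr1n mulr1.
apply: normed_cvg; apply: (series_le_cvg (v_ := geometric 1 r)) => [n|n|n|] //=.
- by rewrite mul1r exprn_ge0.
- rewrite mul1r normrM normfV (normr_nat _ n.+1) -[leRHS]mulr1; apply: ler_pM => //.
  + by apply: (le_trans (dr _)); rewrite exprS ler_piMl ?exprn_ge0// ltW.
  + by rewrite invf_le1 ?ltr0n// ler1n.
- by apply: is_cvg_geometric_series; rewrite ger0_norm.
Qed.

(** The sequences [g N 1] and [h N 1] have two limits each: by continuity the real and imaginary
    parts of (1 - z) exp(A + iB), and by [g1] and [h1] the values 1 and 0. *)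
Lemma cexp_log : exists A B : R,
  [/\ (fun N => log_poly c N 1) @ \oo --> A,
      (fun N => log_poly s N 1) @ \oo --> B &
      (1 - z) * cexp (A +i* B)%C = 1].
Proof.
have /cvg_ex[/= A cA] := log_poly_cvg cr.
have /cvg_ex[/= B sB] := log_poly_cvg sr.
exists A, B; split => //.
have rN : K * (r ^+ N.+1 *+ 2) @[N --> \oo] --> (0 : R).
  rewrite (_ : 0 = K * (0 *+ 2)); last by rewrite mul0rn mulr0.
  apply: cvgM; first exact: cvg_cst.
  apply: cvgMn; rewrite (cvg_shiftS (fun N => r ^+ N)).
  by apply: cvg_expr; rewrite ger0_norm ?cmod_ge0.
have cC : cos (log_poly s N 1) @[N --> \oo] --> cos B.
  by apply: continuous_cvg sB; exact: continuous_cos.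
have cS : sin (log_poly s N 1) @[N --> \oo] --> sin B.
  by apply: continuous_cvg sB; exact: continuous_sin.
have cE : E N 1 @[N --> \oo] --> expR A.
  by apply: continuous_cvg cA; exact: continuous_expR.
have gl : g N 1 @[N --> \oo] --> expR A * ((1 - 1 * a) * cos B + 1 * b * sin B).
  by apply: cvgM cE _; apply: cvgD; apply: cvgM => //; exact: cvg_cst.
have hl : h N 1 @[N --> \oo] --> expR A * ((1 - 1 * a) * sin B - 1 * b * cos B).
  by apply: cvgM cE _; apply: cvgB; apply: cvgM => //; exact: cvg_cst.
have gl1 : g N 1 @[N --> \oo] --> (1 : R).
  apply/subr_cvg0; exact: (cvg_dominated0 g1 rN).
have hl0 : h N 1 @[N --> \oo] --> (0 : R).
  exact: (cvg_dominated0 h1 rN).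
have gE := cvg_unique (@norm_hausdorff _ _) gl gl1.
have hE := cvg_unique (@norm_hausdorff _ _) hl hl0.
rewrite !mul1r in gE hE.
have -> : 1 - z = (1 - a) +i* (- b).
  rewrite /a /b; case: (z) => x y; apply/eqP.
  by rewrite eq_complex /= sub0r !eqxx.
rewrite /cexp /=; apply/eqP; rewrite eq_complex /=.
by apply/andP; split; apply/eqP; [rewrite -[RHS]gE|rewrite -[RHS]hE]; ring.
Qed.

End Ray.

End ComplexLog.

(** * Unordered sums and series *)

Section Series.
Variable R : realType.
Local Notation Re := (@complex.Re R).
Local Notation Im := (@complex.Im R).
Local Notation psum a := (fun N => \sum_(1 <= n < N.+1) a n).

Lemma psumE (a : nat -> R) N :
  \sum_(1 <= n < N.+1) a n = \sum_(0 <= n < N.+1 | (0 < n)%N) a n.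
Proof.
rewrite [RHS]big_mkcond big_nat_recl//= add0r big_add1 /=.
by apply: eq_bigr.
Qed.

(** This passes from unordered sums, where the rearrangement takes place, to the ordered partial
    sums that define the zeta functions. *)
Lemma cvg_psum_esum (a : nat -> R) (S : R) : (forall n, 0 <= a n) ->
  (\esum_(n in [set n | (0 < n)%N]) (a n)%:E = S%:E)%E ->
  psum a @ \oo --> S.
Proof.
move=> a0 aS.
have sa : summable (fun n => 0 < n)%N (fun n => (a n)%:E).
  rewrite /summable (eq_esum (b := fun n => (a n)%:E)) ?aS ?ltry// => n _.
  by rewrite /= ger0_norm.
have a0' n : (0 < n)%N -> (0 <= (a n)%:E)%E by rewrite lee_fin.
have H := summable_nneseries_lim a0' sa.
rewrite nneseries_esum// aS in H; case: H => ->.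
have C := summable_cvg a0' sa.
have -> : psum a = (fun N => (fun N => \sum_(0 <= n < N | (0 < n)%N) a n) N.+1).
  by apply/funext => N; rewrite psumE.
by move: C; rewrite -[X in X -> _]cvg_shiftS.
Qed.

Lemma esum_cvg_psum (a : nat -> R) : (forall n, 0 <= a n) -> cvgn (psum a) ->
  (\esum_(n in [set n | (0 < n)%N]) (a n)%:E < +oo)%E.
Proof.
move=> a0 ca; rewrite -nneseries_esum; last by move=> n _; rewrite lee_fin.
apply: (@le_lt_trans _ _ (limn (psum a))%:E); last exact: ltry.
apply: lime_le; first by apply: is_cvg_nneseries_cond => n _ _; rewrite lee_fin.
apply: nearW => N; rewrite sumEFin lee_fin.
apply: (@le_trans _ _ (psum a N)).
  by rewrite psumE [leRHS]big_mkcond big_nat_recr//= -big_mkcond lerDl; case: ifP.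
apply: (nondecreasing_cvgn_le (u_ := psum a)) => //.
apply/nondecreasing_seqP => n; rewrite [leRHS]big_nat_recr//= lerDl//.
Qed.

Lemma cvg_complex (u : nat -> R[i]^o) (A B : R) :
  (fun N => Re (u N)) @ \oo --> A -> (fun N => Im (u N)) @ \oo --> B ->
  u @ \oo --> ((A +i* B)%C : R[i]^o).
Proof.
move=> /cvgrPdist_lt uA /cvgrPdist_lt uB; apply/cvgrPdist_lt => -[e e'].
(* A positive element of [R[i]] has zero imaginary part, so the tolerance is a real number. *)
rewrite ltcE /= => /andP[/eqP -> e0].
have e2 : 0 < e / 2 by rewrite divr_gt0.
near=> N.
have HA : `|A - Re (u N)| < e / 2 by near: N; exact: uA.
have HB : `|B - Im (u N)| < e / 2 by near: N; exact: uB.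
have -> : (e +i* 0)%C = e%:C%C by [].
rewrite normc_def ltcR; case: (u N) HA HB => x y /=; set p := A - x; set q := B - y => HA HB.
apply: (@le_lt_trans _ _ (`|p| + `|q|)); last lra.
rewrite -[leRHS]ger0_norm ?addr_ge0// -[leRHS]sqrtr_sqr ler_wsqrtr//.
by rewrite [leRHS]sqrrD !real_normK ?num_real// lerD2r lerDl mulrn_wge0 ?mulr_ge0.
Unshelve. all: by end_near.
Qed.

Lemma series1E (a : nat -> R[i]) (A B : R) :
  psum (fun n => Re (a n)) @ \oo --> A -> psum (fun n => Im (a n)) @ \oo --> B ->
  series1 a = (A +i* B)%C.
Proof.
move=> aA aB.
have sE (f : R[i] -> R) : {morph f : x y / x + y} -> f 0 = 0 ->
    (fun N => f (\sum_(1 <= n < N.+1) a n)) = psum (fun n => f (a n)).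
  by move=> fD f0; apply/funext => N; exact: (big_morph f fD f0).
have C : ((fun N : nat => \sum_(1 <= n < N.+1) a n) : nat -> R[i]^o) @ \oo
    --> ((A +i* B)%C : R[i]^o).
  by apply: cvg_complex; rewrite sE// => -[? ?] [].
exact: (cvg_lim (@norm_hausdorff _ _) C).
Qed.

End Series.

(** * The zeta functions *)

Section Zeta.
Variable R : realType.
Implicit Types (z s : R[i]).
Local Notation Re := (@complex.Re R).
Local Notation Im := (@complex.Im R).
Local Notation psum a := (fun N => \sum_(1 <= n < N.+1) a n).
Local Notation F := (@farey R).
Local Notation G := (@gauss R).
Local Notation fixF0 n := (fixF n `&` ~` [set (0 : R)]).

Definition ZF_nonzero n : R := fine (\esum_(x in fixF0 n) (farey_prod n x)%:E).

Lemma ZF_nonzero_ge0 n : 0 <= ZF_nonzero n.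
Proof. by apply/fine_ge0/esum_ge0 => x _; rewrite lee_fin farey_prod_ge0. Qed.

(** The neutral fixed point has weight 1, and [weight_farey] handles the other points; [fine] is
    additive here because their sum is finite. *)
Lemma ZFE n : (0 < n)%N -> ZF R n = 1 + ZF_nonzero n.
Proof.
move=> n0; rewrite /ZF (esumID [set (0 : R)]); last first.
  by move=> x _; rewrite lee_fin; apply: prodr_ge0 => k _; rewrite invr_ge0.
have -> : fixF n `&` [set 0] = [set (0 : R)].
  apply/seteqP; split=> [x []//|x /= ->]; split=> //.
  by split; [rewrite lexx ler01|exact: iter_farey0].
have w0 : weight F n 0 = 1.
  rewrite /weight big1// => k _; rewrite iter_farey0 norm_derive1_farey ?lexx ?ler01//.
    by rewrite /farey_factor invr_ge0 ler0n subr0 expr1n.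
  by rewrite eq_sym invr_eq0 pnatr_eq0.
rewrite esum_set1 w0; last by rewrite lee_fin.
rewrite (eq_esum (b := fun x => (farey_prod n x)%:E)); last first.
  by move=> x [Fx /eqP x0]; rewrite weight_farey.
rewrite fineD//; exact: esum_fixF_fin (farey_prod_ge0 n).
Qed.

Lemma cmod_real (r : R) : 0 <= r -> cmod r%:C = r.
Proof.
by move=> r0; rewrite /cmod /ComplexField.Normc.normc /= expr0n addr0 sqrtr_sqr ger0_norm.
Qed.

Lemma natr_complex n : (n%:R : R[i]) = n%:R%:C.
Proof. by rewrite rmorph_nat. Qed.

Lemma zetaF_termE z n : zetaF_term z n = z ^+ n * (ZF R n / n%:R)%:C.
Proof.
by rewrite /zetaF_term natr_complex -fmorphV -mulrA -rmorphM [_^-1 * _]mulrC.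
Qed.

Lemma cmod_zetaF_term z n : (0 < n)%N ->
  cmod (zetaF_term z n) = cmod z ^+ n / n%:R * (1 + ZF_nonzero n).
Proof.
move=> n0; rewrite zetaF_termE cmodM cmodX cmod_real ZFE//; first by ring.
by rewrite divr_ge0// addr_ge0// ZF_nonzero_ge0.
Qed.

(** Since Z_n(F) is at least 1, for |z| >= 1 the terms would dominate the harmonic series. *)
Lemma zetaF_abs_cvg_lt1 (z : R[i]) : zetaF_abs_cvg z -> cmod z < 1.
Proof.
move=> zF; rewrite ltNge; apply/negP => z1.
have psum_series (a : nat -> R) : psum a = series (fun n => a n.+1).
  by apply/funext => N; rewrite big_add1.
apply: (@dvg_harmonic R).
apply: (series_le_cvg (v_ := fun n => cmod (zetaF_term z n.+1))) => [n|n|n|].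
- by rewrite invr_ge0.
- exact: cmod_ge0.
- rewrite cmod_zetaF_term// -[leLHS]mul1r -[leLHS]mulr1; apply: ler_pM => //.
  + by rewrite mul1r invr_ge0.
  + by rewrite ler_pM// ?invr_ge0// exprn_ege1.
  + by rewrite lerDl ZF_nonzero_ge0.
- by rewrite -(psum_series (fun n => cmod (zetaF_term z n))).
Qed.

(** For infinite [X] both sides are 0, the default value of [fine]. *)
Lemma fineZ (r : R) (X : \bar R) : 0 < r -> fine (r%:E * X)%E = r * fine X.
Proof.
by move=> r0; case: X => [x| |] //=; rewrite ?gt0_muley ?gt0_muleNy ?lte_fin ?mulr0.
Qed.

Lemma cvgB_eq (f u v : nat -> R) (a b : R) : u @ \oo --> a -> v @ \oo --> b ->
  (forall N, f N = u N - v N) -> f @ \oo --> a - b.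
Proof. by move=> ua vb fE; rewrite (funext fE); exact: cvgB. Qed.

Lemma cvgD_eq (f u v : nat -> R) (a b : R) : u @ \oo --> a -> v @ \oo --> b ->
  (forall N, f N = u N + v N) -> f @ \oo --> a + b.
Proof. by move=> ua vb fE; rewrite (funext fE); exact: cvgD. Qed.

(** * Rearrangement of the double sum *)

Section Rearrangement.
Variable z : R[i].
Hypothesis zF : zetaF_abs_cvg z.

(** The Farey series is dominated term by term by the moduli of the terms of zeta_F;
    [esum_gauss_farey] then carries convergence over to the Gauss side, with the same sum. *)
Lemma rearrange_ge0 (b : nat -> R) : (forall n, 0 <= b n <= cmod z ^+ n) ->
  exists A : R,
    psum (fun l => fine (\esum_(x in fixG l) (b (digit_sum l x) * gauss_prod l x)%:E) / l%:R)
      @ \oo --> A /\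
    psum (fun n => b n / n%:R * ZF_nonzero n) @ \oo --> A.
Proof.
move=> bz; have b0 n : 0 <= b n by case/andP: (bz n).
have t0 n : 0 <= b n / n%:R * ZF_nonzero n.
  by rewrite !mulr_ge0 ?invr_ge0 ?ZF_nonzero_ge0.
have Sfin : (\esum_(n in [set n | (0 < n)%N]) (b n / n%:R * ZF_nonzero n)%:E)%E \is a fin_num.
  rewrite ge0_fin_numE; last by apply: esum_ge0 => n _; rewrite lee_fin.
  apply: le_lt_trans (esum_cvg_psum (fun n => cmod_ge0 _) zF).
  apply: le_esum => n /= n0; rewrite lee_fin cmod_zetaF_term//.
  apply: ler_pM; rewrite ?ZF_nonzero_ge0 ?mulr_ge0 ?invr_ge0 ?lerDr//.
  by rewrite ler_pM2r ?invr_gt0 ?ltr0n//; case/andP: (bz n).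
exists (fine (\esum_(n in [set n | (0 < n)%N]) (b n / n%:R * ZF_nonzero n)%:E)%E).
split; last by apply: cvg_psum_esum => //; rewrite fineK.
apply: cvg_psum_esum.
  move=> l; rewrite divr_ge0//; apply/fine_ge0/esum_ge0 => x _.
  by rewrite lee_fin mulr_ge0 ?gauss_prod_ge0.
rewrite fineK//.
have E : (\esum_(l in [set l | (0 < l)%N]) \esum_(x in fixG l)
      (b (digit_sum l x) * gauss_prod l x / l%:R)%:E
    = \esum_(n in [set n | (0 < n)%N]) (b n / n%:R * ZF_nonzero n)%:E)%E.
  rewrite esum_gauss_farey//; apply: eq_esum => n n0.
  by rewrite [RHS]EFinM /ZF_nonzero fineK//; exact: esum_fixF_fin (farey_prod_ge0 n).
rewrite -E; apply: eq_esum => l l0.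
have i0 x : (0 <= (b (digit_sum l x) * gauss_prod l x / l%:R)%:E)%E.
  by rewrite lee_fin !mulr_ge0 ?invr_ge0 ?gauss_prod_ge0.
(* [fine] is faithful only on finite sums; each inner sum is finite because the total is. *)
have lfin : (\esum_(x in fixG l) (b (digit_sum l x) * gauss_prod l x / l%:R)%:E)%E \is a fin_num.
  rewrite ge0_fin_numE; last exact: esum_ge0.
  have /summable_pinfty/(_ _ l0) : summable [set l | (0 < l)%N]
      (fun l => \esum_(x in fixG l) (b (digit_sum l x) * gauss_prod l x / l%:R)%:E)%E.
    rewrite /summable (eq_esum (b := fun l =>
      (\esum_(x in fixG l) (b (digit_sum l x) * gauss_prod l x / l%:R)%:E)%E)).
      by rewrite E -ge0_fin_numE//; apply: esum_ge0 => n _; rewrite lee_fin.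
    move=> k _; rewrite gee0_abs//; apply: esum_ge0 => x _.
    by rewrite lee_fin !mulr_ge0 ?invr_ge0 ?gauss_prod_ge0.
  by rewrite gee0_abs//; exact: esum_ge0.
rewrite -(fineK lfin); congr EFin.
rewrite mulrC -fineZ ?invr_gt0 ?ltr0n// -esumZl ?invr_ge0//; last first.
  by move=> x _; rewrite lee_fin mulr_ge0 ?gauss_prod_ge0.
by congr fine; apply: eq_esum => x _; rewrite -EFinM mulrC.
Qed.

(** The positive and negative parts of [g] are rearranged separately, in accordance with [rsum];
    both are still bounded by |z|^n, and the nonnegative [gauss_prod] passes through the maximum. *)
Lemma rearrange (g : nat -> R) : (forall n, `|g n| <= cmod z ^+ n) ->
  exists A : R,
    psum (fun l => rsum (fixG l) (fun x => g (digit_sum l x) * gauss_prod l x) / l%:R)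
      @ \oo --> A /\
    psum (fun n => g n / n%:R * ZF_nonzero n) @ \oo --> A.
Proof.
move=> gz.
have Mz (h : nat -> R) : (forall n, `|h n| <= cmod z ^+ n) ->
    forall n, 0 <= Num.max (h n) 0 <= cmod z ^+ n.
  move=> hz n; rewrite le_max lexx orbT ge_max exprn_ge0 ?cmod_ge0// andbT.
  exact: le_trans (ler_norm _) (hz n).
have [A1 [G1 F1]] := rearrange_ge0 (Mz _ gz).
have gzN n : `|- g n| <= cmod z ^+ n by rewrite normrN.
have [A2 [G2 F2]] := rearrange_ge0 (Mz (fun n => - g n) gzN).
exists (A1 - A2); split.
  apply: (cvgB_eq G1 G2) => N; rewrite -sumrB; apply: eq_bigr => l _.
  rewrite /rsum mulrBl; congr (fine _ / _ - fine _ / _); apply: eq_esum => x _.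
    by rewrite maxr_pMl ?gauss_prod_ge0// mul0r.
  by rewrite -mulNr maxr_pMl ?gauss_prod_ge0// mul0r.
apply: (cvgB_eq F1 F2) => N; rewrite -sumrB; apply: eq_bigr => n _.
rewrite -!mulrBl; congr (_ / _ * _).
case: (leP 0 (g n)) => h; first by rewrite max_r ?oppr_le0// subr0.
by rewrite max_l ?oppr_ge0 ?(ltW h)//; ring.
Qed.

End Rearrangement.

(** * The two identities *)

Lemma Xi_termE l z x : Xi_term l z x = z ^+ digit_sum l x * (gauss_prod l x)%:C.
Proof. by []. Qed.

Lemma ReMr z (r : R) : Re (z * r%:C) = Re z * r.
Proof. by rewrite Re_mulc /= mulr0 subr0. Qed.

Lemma ImMr z (r : R) : Im (z * r%:C) = Im z * r.
Proof. by rewrite Im_mulc /= mulr0 add0r. Qed.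

Lemma zeta2_term1E z l : zeta2_term (1 : R[i]) z l = Xi l z * (l%:R^-1)%:C.
Proof. by rewrite /zeta2_term expr1n natr_complex -fmorphV mul1r mulrC. Qed.

(** The exponent of zeta_F exceeds that of zeta_2 by A + iB, the contribution of the fixed point 0,
    and [cexp_log] says that its exponential is inverse to 1 - z. *)
Lemma zeta2_zetaF z : zetaF_abs_cvg z -> zeta2 1 z = (1 - z) * zetaF z.
Proof.
move=> zF; have [A [B [cA cB AB]]] := cexp_log (zetaF_abs_cvg_lt1 zF).
have logE d N : @log_poly R d N 1 = \sum_(1 <= n < N.+1) d n / n%:R.
  by rewrite big_add1 big_mkord; apply: eq_bigr => n _; rewrite expr1n mulr1.
have [|Sr [Gr Fr]] := rearrange zF (g := fun n => Re (z ^+ n)).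
  by move=> n; rewrite -cmodX; exact: ler_Re_cmod.
have [|Si [Gi Fi]] := rearrange zF (g := fun n => Im (z ^+ n)).
  by move=> n; rewrite -cmodX; exact: ler_Im_cmod.
have rsumE (f g : R -> R) l : (forall x, f x = g x) ->
    rsum (@fixG R l) f = rsum (fixG l) g.
  by move=> /funext ->.
have E2 : series1 (zeta2_term (1 : R[i]) z) = Sr +i* Si.
  apply: series1E.
    apply: cvg_trans Gr; apply: near_eq_cvg; apply: nearW => N /=.
    apply: eq_bigr => l _; rewrite zeta2_term1E ReMr; congr (_ / _).
    by apply: rsumE => x; rewrite Xi_termE ReMr.
  apply: cvg_trans Gi; apply: near_eq_cvg; apply: nearW => N /=.
  apply: eq_bigr => l _; rewrite zeta2_term1E ImMr; congr (_ / _).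
  by apply: rsumE => x; rewrite Xi_termE ImMr.
have EF : series1 (zetaF_term z) = (A +i* B) + (Sr +i* Si).
  apply: series1E.
    apply: (cvgD_eq cA Fr) => N.
    rewrite logE -big_split; apply: eq_big_nat => n /andP[n0 _] /=.
    by rewrite zetaF_termE ReMr ZFE//; ring.
  apply: (cvgD_eq cB Fi) => N.
  rewrite logE -big_split; apply: eq_big_nat => n /andP[n0 _] /=.
  by rewrite zetaF_termE ImMr ZFE//; ring.
by rewrite /zeta2 /zetaF E2 EF cexpD mulrA AB mul1r.
Qed.

(** At z = 1 the terms are nonnegative reals, so the imaginary and negative parts vanish. Both sides
    are then [fine] of the same extended sum, by [weight_gauss]. *)
Lemma Xi1 l : (0 < l)%N -> Xi l (1 : R[i]) = (ZG R l)%:C.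
Proof.
move=> l0.
have ReE x : Re (Xi_term l 1 x) = gauss_prod l x by rewrite Xi_termE ReMr expr1n mul1r.
have ImE x : Im (Xi_term l 1 x) = 0 by rewrite Xi_termE ImMr expr1n mul0r.
rewrite /Xi /csum (funext ReE) (funext ImE) /rsum oppr0 maxxx subrr; congr (_ +i* _).
rewrite [X in _ - fine X]esum1 ?subr0; last first.
  by move=> x _; rewrite max_r// oppr_le0 gauss_prod_ge0.
congr fine; apply: eq_esum => x Gx; rewrite max_l ?gauss_prod_ge0//.
by rewrite weight_gauss.
Qed.

Lemma eq_series1 (a b : nat -> R[i]) : (forall n, (0 < n)%N -> a n = b n) ->
  series1 a = series1 b.
Proof.
move=> ab; rewrite /series1.
suff -> : (fun N => \sum_(1 <= n < N.+1) a n) = (fun N => \sum_(1 <= n < N.+1) b n) by [].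
by apply/funext => N; apply: eq_big_nat => n /andP[n0 _]; exact: ab.
Qed.

Lemma zeta2_zetaG (s : R[i]) : zeta2 s 1 = zetaG s.
Proof. by congr cexp; apply: eq_series1 => n n0; rewrite /zeta2_term Xi1. Qed.

End Zeta.

Theorem proposition3 (R : realType) :
  (forall z : R[i],
     zeta2_abs_cvg 1 z -> zetaF_abs_cvg z ->
     zeta2 1 z = (1 - z) * zetaF z)
  /\
  (forall s : R[i],
     zeta2_abs_cvg s 1 -> zetaG_abs_cvg s ->
     zeta2 s 1 = zetaG s).
Proof.
split=> [z _|s _ _]; first exact: zeta2_zetaF.
exact: zeta2_zetaG.
Qed.
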